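(* Let $M\in\mathbb{C}^{p\times p}$ be invertible, let $\mathcal{A}\in\mathbb{C}^{m\times n\times p}$ have multirank $\mathrm{rank}_M(\mathcal{A})=(r,r,\ldots,r)$, and let $\mathcal{B}\in\mathbb{C}^{m\times m\times p}$ have tubal index $k$. (i) If $\mathcal{A}^*=\mathcal{Q}*_M\mathcal{D}*_M\mathcal{R}$ is an $M$-$\mathcal{QDR}$ decomposition of $\mathcal{A}^*$, then $\mathcal{A}^\dagger=\mathcal{Q}*_M(\mathcal{R}*_M\mathcal{A}*_M\mathcal{Q})^{-1}*_M\mathcal{R}$. (ii) If $\mathcal{B}^k=\mathcal{Q}*_M\mathcal{D}*_M\mathcal{R}$ is an $M$-$\mathcal{QDR}$ decomposition of $\mathcal{B}^k$, then $\mathcal{B}^{D}=\mathcal{Q}*_M(\mathcal{R}*_M\mathcal{B}*_M\mathcal{Q})^{-1}*_M\mathcal{R}$.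
   Context: $\mathbb{C}(x)$ is the field of rational functions over $\mathbb{C}$; tensors over $\mathbb{C}$ are regarded as tensors over $\mathbb{C}(x)$ whenever needed, and the notions below are used over both fields $\mathbb{K}\in\{\mathbb{C},\mathbb{C}(x)\}$. For $\mathcal{A}\in\mathbb{K}^{m\times n\times p}$ and an invertible $M\in\mathbb{C}^{p\times p}$, let $\tilde{\mathcal{A}}=\mathcal{A}\times_3 M$, i.e. $\tilde{\mathcal{A}}(i,j,k)=\sum_{l=1}^p M(k,l)\,\mathcal{A}(i,j,l)$; its $k$-th frontal slice is the matrix $\tilde{\mathcal{A}}(:,:,k)$. M-product: for $\mathcal{A}\in\mathbb{K}^{m\times n\times p}$ and $\mathcal{B}\in\mathbb{K}^{n\times q\times p}$, $\mathcal{A}*_M\mathcal{B}\in\mathbb{K}^{m\times q\times p}$ is the unique tensor $\mathcal{C}$ with $\tilde{\mathcal{C}}(:,:,k)=\tilde{\mathcal{A}}(:,:,k)\tilde{\mathcal{B}}(:,:,k)$ for all $k=1,\ldots,p$. Powers are taken with respect to $*_M$; $\mathcal{B}^0$ is the identity tensor, whose transform has all frontal slices equal to the identity matrix. A tensor $\mathcal{A}\in\mathbb{K}^{n\times n\times p}$ is invertible if every frontal slice of $\tilde{\mathcal{A}}$ is invertible; then $\widetilde{\mathcal{A}^{-1}}(:,:,k)=(\tilde{\mathcal{A}}(:,:,k))^{-1}$. Conjugate transpose: for $\mathcal{A}\in\mathbb{C}^{m\times n\times p}$, $\mathcal{A}^*\in\mathbb{C}^{n\times m\times p}$ is the tensor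 with $\widetilde{\mathcal{A}^*}(:,:,k)=(\tilde{\mathcal{A}}(:,:,k))^*$ for all $k$. Multirank: $\mathrm{rank}_M(\mathcal{A})=(r_1,\ldots,r_p)$ with $r_k=\mathrm{rank}(\tilde{\mathcal{A}}(:,:,k))$. Tubal rank: $\mathrm{rank}_t(\mathcal{A})=\max_k r_k$. $M$-$\mathcal{QDR}$ decomposition: for $\mathcal{A}\in\mathbb{C}(x)^{m\times n\times p}$ with $\mathrm{rank}_t(\mathcal{A})=r$, $\mathcal{A}=\mathcal{Q}*_M\mathcal{D}*_M\mathcal{R}$ is an $M$-$\mathcal{QDR}$ decomposition of $\mathcal{A}$ if $\mathcal{Q}\in\mathbb{C}(x)^{m\times r\times p}$, $\mathcal{D}\in\mathbb{C}(x)^{r\times r\times p}$, $\mathcal{R}\in\mathbb{C}(x)^{r\times n\times p}$ satisfy $\tilde{\mathcal{Q}}(:,j,:)\ne\mathbf{0}$, $\tilde{\mathcal{R}}(i,:,:)\ne\mathbf{0}$, $\tilde{\mathcal{D}}(i,:,:)\ne\mathbf{0}$ and $\tilde{\mathcal{D}}(:,j,:)\ne\mathbf{0}$ for all $i,j=1,\ldots,r$. Moore-Penrose inverse: for $\mathcal{A}\in\mathbb{C}^{m\times n\times p}$, $\mathcal{A}^{\dagger}\in\mathbb{C}^{n\times m\times p}$ is the unique tensor $\mathcal{Z}$ with $\mathcal{A}*_M\mathcal{Z}*_M\mathcal{A}=\mathcal{A}$, $\mathcal{Z}*_M\mathcal{A}*_M\mathcal{Z}=\mathcal{Z}$, $(\mathcal{A}*_M\mathcal{Z})^*=\mathcal{A}*_M\mathcal{Z}$,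 $(\mathcal{Z}*_M\mathcal{A})^*=\mathcal{Z}*_M\mathcal{A}$. Index: for a square matrix $A$, $\mathrm{ind}(A)$ is the least integer $k\ge 0$ with $\mathrm{rank}(A^k)=\mathrm{rank}(A^{k+1})$. The tubal index of $\mathcal{B}$ is $\max_{1\le i\le p}\mathrm{ind}(\tilde{\mathcal{B}}(:,:,i))$. Drazin inverse: if $\mathcal{B}\in\mathbb{C}^{m\times m\times p}$ has tubal index $k$, $\mathcal{B}^D$ is the unique $\mathcal{Z}\in\mathbb{C}^{m\times m\times p}$ with $\mathcal{Z}*_M\mathcal{B}*_M\mathcal{Z}=\mathcal{Z}$, $\mathcal{B}*_M\mathcal{Z}=\mathcal{Z}*_M\mathcal{B}$ and $\mathcal{Z}*_M\mathcal{B}^{k+1}=\mathcal{B}^k$.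
   Formalization: Part (ii) additionally assumes that B^k has constant multirank (s,...,s); without this the claim is false (e.g. p=2, M=I, slices diag(1,0) and E_12), and whenever the formula makes sense and holds the multirank of B^k is constant. *)

(* Defs.v *)
From HB Require Import structures.
From mathcomp Require Import all_boot all_order all_algebra.
From mathcomp Require Import boolp classical_sets reals.
From mathcomp Require Import complex.
Set Implicit Arguments.
Unset Strict Implicit.
Unset Printing Implicit Defensive.
Import Order.TTheory GRing.Theory Num.Theory.
Local Open Scope ring_scope.

(* A k is the k-th frontal slice A(:,:,k). *)
Definition tensor (K : Type) (m n p : nat) : Type :=
  {ffun 'I_p -> 'M[K]_(m, n)}.

Section MProduct.
Variables (K : fieldType) (p : nat) (M : 'M[K]_p).

(* \tilde A = A x_3 M *)
Definition transform m n (A : tensor K m n p) : tensor K m n p :=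
  [ffun k => \sum_l M k l *: A l].

(* A x_3 M^-1; a two-sided inverse of transform when M is invertible, see
   transformK and untransformK. *)
Definition untransform m n (A : tensor K m n p) : tensor K m n p :=
  [ffun k => \sum_l invmx M k l *: A l].

Definition mprod m n q (A : tensor K m n p) (B : tensor K n q p) :
    tensor K m q p :=
  untransform [ffun k => transform A k *m transform B k].

Definition mone n : tensor K n n p := untransform [ffun=> 1%:M].

Definition mpow n (B : tensor K n n p) (k : nat) : tensor K n n p :=
  iter k (mprod B) (mone n).

Definition minvertible n (A : tensor K n n p) : Prop :=
  forall k, transform A k \in unitmx.

Definition minv n (A : tensor K n n p) : tensor K n n p :=
  untransform [ffun k => invmx (transform A k)].

Definition multirank m n (A : tensor K m n p) : {ffun 'I_p -> nat} :=
  [ffun k => \rank (transform A k)].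

Definition tubal_rank m n (A : tensor K m n p) : nat :=
  (\max_k multirank A k)%N.

End MProduct.

(* T(i,:,:) and T(:,j,:) *)
Definition horizontal_slice (K : Type) m n p (T : tensor K m n p) (i : 'I_m) :
  'M[K]_(n, p) := \matrix_(j, k) T k i j.
Definition lateral_slice (K : Type) m n p (T : tensor K m n p) (j : 'I_n) :
  'M[K]_(m, p) := \matrix_(i, k) T k i j.

Definition is_MQDR (K : fieldType) p (M : 'M[K]_p) m n r (A : tensor K m n p)
    (Q : tensor K m r p) (D : tensor K r r p) (R : tensor K r n p) : Prop :=
  [/\ tubal_rank M A = r,
      A = mprod M (mprod M Q D) R,
      forall j, lateral_slice (transform M Q) j <> 0,
      forall i, horizontal_slice (transform M R) i <> 0
    & (forall i, horizontal_slice (transform M D) i <> 0) /\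
      (forall j, lateral_slice (transform M D) j <> 0)].

Lemma index_exists (K : fieldType) n (A : 'M[K]_n) :
  exists k, \rank (A ^+ k) == \rank (A ^+ k.+1).
Proof.
have le k : (\rank (A ^+ k.+1) <= \rank (A ^+ k))%N.
  by rewrite exprSr; apply: mxrankM_maxl.
case: (boolP [exists k : 'I_n.+1, \rank (A ^+ k) == \rank (A ^+ k.+1)]).
  by case/existsP=> k Hk; exists k.
rewrite negb_exists => /forallP H.
have bnd k : (k <= n.+1)%N -> (\rank (A ^+ k) + k <= n)%N.
  elim: k => [_|k IH lt_k]; first by rewrite addn0 rank_leq_row.
  apply: leq_trans (IH (ltnW lt_k)); rewrite addnS -addSn leq_add2r.
  by have /= := H (Ordinal lt_k); rewrite ltn_neqAle eq_sym le andbT.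
by have := bnd n.+1 (leqnn _); rewrite addnS ltnNge leq_addl.
Qed.

Definition ind (K : fieldType) n (A : 'M[K]_n) : nat :=
  ex_minn (index_exists A).

Definition tubal_index (K : fieldType) p (M : 'M[K]_p) n (B : tensor K n n p) :
  nat := (\max_i ind (transform M B i))%N.

Definition conj_transpose (C : numClosedFieldType) p (M : 'M[C]_p) m n
    (A : tensor C m n p) : tensor C n m p :=
  untransform M [ffun k => map_mx Num.conj (transform M A k)^T].

Definition is_MP (C : numClosedFieldType) p (M : 'M[C]_p) m n
    (A : tensor C m n p) (Z : tensor C n m p) : Prop :=
  [/\ mprod M (mprod M A Z) A = A,
      mprod M (mprod M Z A) Z = Z,
      conj_transpose M (mprod M A Z) = mprod M A Z
    & conj_transpose M (mprod M Z A) = mprod M Z A].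

(* The default value 0 is irrelevant for invertible M, see MP_unique_exists. *)
Definition MPinv (C : numClosedFieldType) p (M : 'M[C]_p) m n
    (A : tensor C m n p) : tensor C n m p :=
  xget (0 : {ffun 'I_p -> 'M[C]_(n, m)}) [set Z | is_MP M A Z].

Definition is_Drazin (K : fieldType) p (M : 'M[K]_p) m
    (B Z : tensor K m m p) : Prop :=
  let k := tubal_index M B in
  [/\ mprod M (mprod M Z B) Z = Z,
      mprod M B Z = mprod M Z B
    & mprod M Z (mpow M B k.+1) = mpow M B k].

(* The default value 0 is irrelevant for invertible M, see
   Drazin_unique_exists. *)
Definition Drazin_inv (K : fieldType) p (M : 'M[K]_p) m
    (B : tensor K m m p) : tensor K m m p :=
  xget (0 : {ffun 'I_p -> 'M[K]_m}) [set Z | is_Drazin M B Z].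

Notation ratfun C := {fraction {poly C}}.

Definition ratfunC (C : fieldType) (c : C) : ratfun C := tofrac c%:P.

Section RatfunC.
Variable C : fieldType.
Let ratfunC_zmod : zmod_morphism (@ratfunC C).
Proof. by move=> x y; rewrite /ratfunC !rmorphB. Qed.
Let ratfunC_monoid : monoid_morphism (@ratfunC C).
Proof. by split=> [|x y]; rewrite /ratfunC ?rmorph1 ?rmorphM. Qed.
HB.instance Definition _ :=
  GRing.isZmodMorphism.Build C (ratfun C) (@ratfunC C) ratfunC_zmod.
HB.instance Definition _ :=
  GRing.isMonoidMorphism.Build C (ratfun C) (@ratfunC C) ratfunC_monoid.
End RatfunC.

Definition tensor_ratfun (C : fieldType) m n p (A : tensor C m n p) :
  tensor (ratfun C) m n p := [ffun k => map_mx (@ratfunC C) (A k)].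

Section Characterizations.
Variables (K : fieldType) (p : nat) (M : 'M[K]_p).
Hypothesis uM : M \in unitmx.

Lemma transformK m n : cancel (@transform K p M m n) (@untransform K p M m n).
Proof.
move=> A; apply/ffunP=> k; rewrite ffunE.
under eq_bigr do rewrite ffunE scaler_sumr.
rewrite exchange_big /= (bigD1 k) //= [X in _ + X]big1 => [|l neq].
  under eq_bigr do rewrite scalerA.
  rewrite -scaler_suml addr0; have := congr1 (fun N : 'M_p => N k k) (mulVmx uM).
  by rewrite !mxE eqxx => ->; rewrite scale1r.
under eq_bigr do rewrite scalerA.
rewrite -scaler_suml; have := congr1 (fun N : 'M_p => N k l) (mulVmx uM).
by rewrite !mxE eq_sym (negPf neq) => ->; rewrite scale0r.
Qed.

Lemma untransformK m n : cancel (@untransform K p M m n) (@transform K p M m n).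
Proof.
move=> A; apply/ffunP=> k; rewrite ffunE.
under eq_bigr do rewrite ffunE scaler_sumr.
rewrite exchange_big /= (bigD1 k) //= [X in _ + X]big1 => [|l neq].
  under eq_bigr do rewrite scalerA.
  rewrite -scaler_suml addr0; have := congr1 (fun N : 'M_p => N k k) (mulmxV uM).
  by rewrite !mxE eqxx => ->; rewrite scale1r.
under eq_bigr do rewrite scalerA.
rewrite -scaler_suml; have := congr1 (fun N : 'M_p => N k l) (mulmxV uM).
by rewrite !mxE eq_sym (negPf neq) => ->; rewrite scale0r.
Qed.

Lemma eq_transform m n (A B : tensor K m n p) :
  (forall k, transform M A k = transform M B k) -> A = B.
Proof.
by move=> eqAB; apply: (can_inj (@transformK m n)); apply/ffunP.
Qed.

Lemma transform_mprod m n q (A : tensor K m n p) (B : tensor K n q p) k :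
  transform M (mprod M A B) k = transform M A k *m transform M B k.
Proof. by rewrite untransformK ffunE. Qed.

Lemma mprod_unique m n q (A : tensor K m n p) (B : tensor K n q p) T :
  (forall k, transform M T k = transform M A k *m transform M B k) ->
  T = mprod M A B.
Proof.
by move=> H; apply: eq_transform => k; rewrite H transform_mprod.
Qed.

Lemma transform_mone n k : transform M (mone M n) k = 1%:M.
Proof. by rewrite untransformK ffunE. Qed.

Lemma transform_minv n (A : tensor K n n p) k :
  transform M (minv M A) k = invmx (transform M A k).
Proof. by rewrite untransformK ffunE. Qed.

Lemma transform_mpow n (B : tensor K n n p) j k :
  transform M (mpow M B j) k = transform M B k ^+ j.
Proof.
elim: j => [|j IHj]; first by rewrite transform_mone expr0.
by rewrite [mpow _ _ _]/(mprod M B (mpow M B j)) transform_mprod IHj exprS.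
Qed.

End Characterizations.

Lemma transform_conj (C : numClosedFieldType) p (M : 'M[C]_p) m n
    (A : tensor C m n p) k : M \in unitmx ->
  transform M (conj_transpose M A) k = map_mx Num.conj (transform M A k)^T.
Proof. by move=> uM; rewrite untransformK // ffunE. Qed.

Lemma full_rank_factor (K : fieldType) m n (A : 'M[K]_(m, n)) :
  exists r (F : 'M_(m, r)) (G : 'M_(r, n)),
    [/\ \rank A = r, A = F *m G, row_full F & row_free G].
Proof.
exists (\rank A), (col_base A), (row_base A); split=> //.
- by rewrite mulmx_base.
- exact: col_base_full.
- exact: row_base_free.
Qed.

Section MoorePenrose.
Variable C : numClosedFieldType.
Local Notation "A ^*t" := (map_mx Num.conj A^T) (at level 8).

Let ctM m n q (A : 'M[C]_(m, n)) (B : 'M[C]_(n, q)) :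
  (A *m B)^*t = B^*t *m A^*t.
Proof. by rewrite trmx_mul map_mxM. Qed.

Let ctK m n (A : 'M[C]_(m, n)) : A^*t^*t = A.
Proof. by apply/matrixP=> i j; rewrite !mxE conjCK. Qed.

Let ct_eq0 n (u : 'rV[C]_n) : u *m u^*t = 0 -> u = 0.
Proof.
move=> /matrixP/(_ 0 0); rewrite !mxE.
under eq_bigr do rewrite !mxE.
move/eqP; rewrite psumr_eq0 => [|j _]; last exact: mul_conjC_ge0.
move/allP=> H; apply/matrixP=> i j; rewrite ord1 mxE.
by have /H := mem_index_enum j; rewrite mul_conjC_eq0 => /eqP.
Qed.

Let gram_unit r n (H : 'M[C]_(r, n)) : row_free H -> H *m H^*t \in unitmx.
Proof.
move=> fH; rewrite -row_free_unit -kermx_eq0; apply/rowV0P => u /sub_kermxP.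
rewrite mulmxA => u0; apply/eqP; rewrite -(mulmx_free_eq0 _ fH); apply/eqP.
by apply: ct_eq0; rewrite ctM mulmxA u0 mul0mx.
Qed.

Let MPmx m n (A : 'M[C]_(m, n)) (Z : 'M[C]_(n, m)) :=
  [/\ A *m Z *m A = A, Z *m A *m Z = Z, (A *m Z)^*t = A *m Z
    & (Z *m A)^*t = Z *m A].

Let ct_inv n (A : 'M[C]_n) : A^*t = A -> (invmx A)^*t = invmx A.
Proof. by move=> H; rewrite trmx_inv map_invmx H. Qed.

Let MPmx_exists m n (A : 'M[C]_(m, n)) : exists Z, MPmx A Z.
Proof.
have [r [F [G [_ AE fF fG]]]] := full_rank_factor A.
have uG : G *m G^*t \in unitmx by apply: gram_unit.
have uF : F^*t *m F \in unitmx.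
  have := @gram_unit _ _ F^*t; rewrite ctK; apply.
  by rewrite /row_free mxrank_map mxrank_tr; apply: fF.
set iG := invmx (G *m G^*t); set iF := invmx (F^*t *m F).
have hG : iG^*t = iG by apply: ct_inv; rewrite ctM ctK.
have hF : iF^*t = iF by apply: ct_inv; rewrite ctM ctK.
have AZ : A *m (G^*t *m iG *m iF *m F^*t) = F *m iF *m F^*t.
  by rewrite AE !mulmxA -[F *m G *m _]mulmxA -[F *m _ *m iG]mulmxA mulmxV ?mulmx1.
have ZA : G^*t *m iG *m iF *m F^*t *m A = G^*t *m iG *m G.
  rewrite AE !mulmxA -[_ *m F^*t *m F]mulmxA -[_ *m iF *m (F^*t *m F)]mulmxA.
  by rewrite mulVmx ?mulmx1.
exists (G^*t *m iG *m iF *m F^*t); split.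
- rewrite AZ {1}AE mulmxA -[_ *m F^*t *m F]mulmxA -[F *m iF *m _]mulmxA.
  by rewrite mulVmx ?mulmx1.
- rewrite ZA !mulmxA -[_ *m G *m G^*t]mulmxA -[_ *m iG *m (G *m G^*t)]mulmxA.
  by rewrite mulVmx ?mulmx1.
- by rewrite AZ !ctM ctK hF mulmxA.
- by rewrite ZA !ctM ctK hG mulmxA.
Qed.

Let MPmx_unique m n (A : 'M[C]_(m, n)) Y Z : MPmx A Y -> MPmx A Z -> Y = Z.
Proof.
case=> [y1 y2 y3 y4] [z1 z2 z3 z4].
have e1 : A *m Y = A *m Z.
  rewrite -y3 -{1}z1 -[A *m Z *m A *m Y]mulmxA ctM y3 z3 mulmxA.
  by rewrite y1.
have e2 : Y *m A = Z *m A.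
  rewrite -y4 -{1}z1 -[A *m Z *m A]mulmxA mulmxA ctM y4 z4 -mulmxA.
  by rewrite [A *m _]mulmxA y1.
by rewrite -y2 e2 -mulmxA e1 mulmxA z2.
Qed.

Lemma is_MPP p (M : 'M[C]_p) m n (A : tensor C m n p) Z : M \in unitmx ->
  is_MP M A Z <-> forall k, MPmx (transform M A k) (transform M Z k).
Proof.
move=> uM; split=> [[h1 h2 h3 h4] k|H].
  by split; rewrite -!(transform_mprod uM) -?(transform_conj _ _ uM)
    ?(h1, h2, h3, h4).
split; apply: (eq_transform uM) => k; case: (H k) => [h1 h2 h3 h4];
  by rewrite ?(transform_conj _ _ uM) ?(transform_mprod uM).
Qed.

Lemma MP_unique_exists p (M : 'M[C]_p) m n (A : tensor C m n p) :
  M \in unitmx -> exists! Z, is_MP M A Z.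
Proof.
move=> uM; have [Z HZ] := choice (fun k => MPmx_exists (transform M A k)).
have E k : transform M (untransform M [ffun k => Z k]) k = Z k.
  by rewrite untransformK // ffunE.
exists (untransform M [ffun k => Z k]); split=> [|Y].
  by apply/(is_MPP _ _ uM) => k; rewrite E; apply: HZ.
move/(is_MPP _ _ uM) => HY; apply: (eq_transform uM) => k.
by rewrite E; apply: MPmx_unique (HZ k) (HY k).
Qed.

Lemma MPinvP p (M : 'M[C]_p) m n (A : tensor C m n p) :
  M \in unitmx -> is_MP M A (MPinv M A).
Proof.
move=> uM; have [Z [HZ _]] := MP_unique_exists A uM.
exact: (@xgetI {ffun 'I_p -> 'M[C]_(n, m)} _ [set Z | is_MP M A Z] Z).
Qed.

End MoorePenrose.

Section Drazin.
Variable K : fieldType.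

Let rank_stable n (A : 'M[K]_n) k : (ind A <= k)%N ->
  forall j, \rank (A ^+ (k + j)) = \rank (A ^+ k).
Proof.
rewrite /ind; case: ex_minnP => i /eqP ri _ le_ik.
have sub : (A ^+ i <= A ^+ i.+1)%MS.
  by rewrite -(geq_leqif (mxrank_leqif_sup _)) ?ri // exprS submxMl.
have base j : \rank (A ^+ (i + j)) = \rank (A ^+ i).
  suff H : (A ^+ i <= A ^+ (i + j))%MS.
    by apply/eqP; rewrite eqn_leq !mxrankS // addnC exprD submxMl.
  elim: j => [|j IHj]; first by rewrite addn0.
  apply: submx_trans sub _; rewrite exprSr addnS exprSr.
  exact: submxMr.
by move=> j; rewrite -(subnKC le_ik) -addnA !base.
Qed.

Let Dmx n k (B Z : 'M[K]_n) :=
  [/\ Z * B * Z = Z, B * Z = Z * B & Z * B ^+ k.+1 = B ^+ k].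

Let Dmx_exists n k (B : 'M[K]_n) : (ind B <= k)%N -> exists Z, Dmx k B Z.
Proof.
move=> le_k; have [r [F [G [rB BE fF fG]]]] := full_rank_factor (B ^+ k).
set N := G *m B *m F.
have uN : N \in unitmx.
  rewrite -row_free_unit /row_free eqn_leq rank_leq_row /=.
  have e : B ^+ (k + k.+1) = F *m N *m G.
    by rewrite exprD exprS BE !mulmxA /N -!mulmxE !mulmxA.
  rewrite -{1}rB -(rank_stable le_k k.+1) e.
  exact: leq_trans (mxrankM_maxl _ _) (mxrankM_maxr _ _).
have Bk1 : B *m (F *m G) = F *m G *m B by rewrite -BE !mulmxE -exprS -exprSr.
have [G' GG'] : exists G', G *m G' = 1%:M.
  exact/row_freeP.
have [F' F'F] : exists F', F' *m F = 1%:M.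
  exact/row_fullP.
set c := F' *m B *m F.
have BF : B *m F = F *m c.
  have E : B *m F = F *m (G *m B *m G').
    rewrite -[LHS]mulmx1 -GG' !mulmxA -[B *m F *m G]mulmxA Bk1.
    by rewrite -!mulmxA.
  by rewrite /c -mulmxA E [F' *m _]mulmxA F'F mul1mx.
have GB : G *m B = c *m G.
  rewrite /c -!mulmxA Bk1 -[F *m G *m B]mulmxA mulmxA F'F.
  by rewrite mul1mx.
have cN : c *m N = N *m c.
  by rewrite {1}/N -[G *m B *m F]mulmxA BF /N GB -!mulmxA.
have ciN : c *m invmx N = invmx N *m c.
  apply: (can_inj (mulKmx uN)); rewrite mulmxA -cN -mulmxA mulmxV //.
  by rewrite mulmx1 mulKVmx.
exists (F *m invmx N *m G); split.
- rewrite -!mulmxE; rewrite !mulmxA -[_ *m G *m B]mulmxA.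
  rewrite -[_ *m (G *m B) *m F]mulmxA -/N -[F *m invmx N *m N]mulmxA mulVmx //.
  by rewrite mulmx1.
- by rewrite -!mulmxE !mulmxA BF -[_ *m G *m B]mulmxA GB -[F *m c *m _]mulmxA ciN
     !mulmxA.
- rewrite exprS BE -!mulmxE !mulmxA -[_ *m G *m B]mulmxA.
  rewrite -[_ *m (G *m B) *m F]mulmxA -/N -[F *m invmx N *m N]mulmxA mulVmx //.
  by rewrite mulmx1.
Qed.

Let Dmx_unique n k (B Y Z : 'M[K]_n) : Dmx k B Y -> Dmx k B Z -> Y = Z.
Proof.
move=> [y1 y2 y3] [z1 z2 z3].
have idem (X : 'M[K]_n) j : X * B * X = X -> B * X = X * B ->
    X = X ^+ j.+1 * B ^+ j.
  move=> x1 x2; elim: j => [|j IHj]; first by rewrite expr1 expr0 mulr1.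
  have XXB : X * X * B = X by rewrite -mulrA -x2 mulrA.
  rewrite exprSr exprSr exprS mulrA -[X ^+ j * X * X]mulrA.
  by rewrite -[_ * (X * X) * B]mulrA XXB -exprSr -IHj.
have YB : GRing.comm Y B by rewrite /GRing.comm y2.
have eY : Y = Z * B * Y.
  rewrite [LHS](idem Y k) // -(commrX k.+1 (commr_sym (commrX k YB))).
  rewrite -z3 exprS [Z * (B * _)]mulrA -[_ * B ^+ k * _]mulrA.
  by rewrite (commrX k.+1 (commr_sym (commrX k YB))) -idem.
rewrite eY [RHS](idem Z k) // -y3 (commrX k.+1 YB).
by rewrite [B ^+ k.+1]exprSr !mulrA -idem.
Qed.

Lemma is_DrazinP p (M : 'M[K]_p) m (B Z : tensor K m m p) : M \in unitmx ->
  is_Drazin M B Z <->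
  forall i, Dmx (tubal_index M B) (transform M B i) (transform M Z i).
Proof.
move=> uM; rewrite /is_Drazin; split=> [[h1 h2 h3] i|H].
  by split; rewrite -?(transform_mpow uM) -!mulmxE -!(transform_mprod uM)
    ?(h1, h2, h3).
split; apply: (eq_transform uM) => i; case: (H i) => [h1 h2 h3];
  by rewrite !(transform_mprod uM) ?(transform_mpow uM) ?mulmxE
    -?exprS ?(h1, h2, h3).
Qed.

Lemma Drazin_unique_exists p (M : 'M[K]_p) m (B : tensor K m m p) :
  M \in unitmx -> exists! Z, is_Drazin M B Z.
Proof.
move=> uM; have ex i : exists Z, Dmx (tubal_index M B) (transform M B i) Z.
  by apply: Dmx_exists; apply: leq_bigmax.
have [Z HZ] := choice ex.
have E i : transform M (untransform M [ffun i => Z i]) i = Z i.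
  by rewrite untransformK // ffunE.
exists (untransform M [ffun i => Z i]); split=> [|Y].
  by apply/(is_DrazinP _ _ uM) => i; rewrite E; apply: HZ.
move/(is_DrazinP _ _ uM) => HY; apply: (eq_transform uM) => i.
by rewrite E; apply: Dmx_unique (HZ i) (HY i).
Qed.

Lemma Drazin_invP p (M : 'M[K]_p) m (B : tensor K m m p) :
  M \in unitmx -> is_Drazin M B (Drazin_inv M B).
Proof.
move=> uM; have [Z [HZ _]] := Drazin_unique_exists B uM.
exact: (@xgetI {ffun 'I_p -> 'M[K]_m} _ [set Z | is_Drazin M B Z] Z).
Qed.

End Drazin.

(* Main.v *)
Require Import Defs.
From mathcomp Require Import all_boot all_order all_algebra.
From mathcomp Require Import boolp classical_sets reals.
From mathcomp Require Import complex.
Set Implicit Arguments.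
Unset Strict Implicit.
Unset Printing Implicit Defensive.
Import GRing.Theory.
Local Open Scope ring_scope.

(** Both inverses are outer inverses with prescribed range and kernel: on every
    frontal slice, the Moore-Penrose inverse of A has the row and column spaces
    of A^*, and the Drazin inverse of B has those of B^k.  With W standing for
    A^* or B^k, such an inverse Z also satisfies Z A W = W.

    If W = Q D S where the inner dimension r is the rank of W, then Q has full
    column rank, S has full row rank and D is invertible.  Hence Z, whose row and
    column spaces lie in those of W, factors as Z = Q P S, and cancelling Q, D
    and S in Z A W = W leaves P (S A Q) = 1.  So S A Q is invertible with inverse
    P, and Z = Q (S A Q)^-1 S (lemma [outer_inverse_factor]).

    The argument works over any field and all its hypotheses on A, W and Z (rank,
    inclusions of row spaces, matrix identities) survive extension of scalars
    from C to C(x), where Q, D and S live; the transform turns the statement on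
    tensors into this one, slice by slice (lemma [MQDR_outer_inverse]). *)

(** Z = A^(2)_(T,U), the outer inverse of A whose range T and kernel U are those
    of W.  Two inclusions suffice to say so, since Z A W = W forces the rank of Z
    to be at least that of W; then Z A Z = Z follows, as Z = W X for some X. *)
Definition outer_inverse (K : fieldType) m n
    (A : 'M[K]_(m, n)) (W Z : 'M[K]_(n, m)) : Prop :=
  [/\ (Z <= W)%MS, (Z^T <= W^T)%MS & Z *m A *m W = W].

(** Each factor has rank at least that of the product, hence exactly r. *)
Lemma tight_factors (K : fieldType) m n r (Q : 'M[K]_(n, r)) (D : 'M[K]_r)
    (S : 'M[K]_(r, m)) :
  \rank (Q *m D *m S) = r -> [/\ row_full Q, D \in unitmx & row_free S].
Proof.
move=> rW.
have leQD : (r <= \rank (Q *m D))%N by rewrite -{1}rW mxrankM_maxl.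
split.
- by rewrite -col_leq_rank; apply: leq_trans leQD (mxrankM_maxl _ _).
- rewrite -row_free_unit -row_leq_rank.
  exact: leq_trans leQD (mxrankM_maxr _ _).
- by rewrite -row_leq_rank -{1}rW mxrankM_maxr.
Qed.

Lemma outer_inverse_factor (K : fieldType) m n r (A : 'M[K]_(m, n))
    (W Z : 'M[K]_(n, m)) (Q : 'M[K]_(n, r)) (D : 'M[K]_r) (S : 'M[K]_(r, m)) :
  outer_inverse A W Z -> W = Q *m D *m S -> \rank W = r ->
  S *m A *m Q \in unitmx /\ Z = Q *m invmx (S *m A *m Q) *m S.
Proof.
move=> [/submxP[Y ZY] sZW ZAW] WE rW.
have [fQ uD fS] : [/\ row_full Q, D \in unitmx & row_free S].
  by apply: tight_factors; rewrite -WE.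
have [Q' Q'Q] := row_fullP fQ; have [S' SS'] := row_freeP fS.
have [V ZV] : exists V, Z = Q *m V.
  have /submxP[V VE] := sZW; exists (D *m S *m V^T).
  by rewrite -[LHS]trmxK VE trmx_mul trmxK WE !mulmxA.
pose P := V *m S'.
have ZP : Z = Q *m P *m S.
  (* S' S fixes Z on the right, as the rows of Z are spanned by those of S *)
  have ZK : Z *m S' *m S = Z.
    by rewrite ZY WE -!mulmxA (mulmxA S) SS' mul1mx.
  by rewrite /P mulmxA -ZV ZK.
have PN : P *m (S *m A *m Q) = 1%:M.
  apply: (can_inj (mulmxK uD)); apply: (row_free_inj fS).
  rewrite mul1mx -[LHS]mul1mx -[RHS]mul1mx -Q'Q -!mulmxA; congr (Q' *m _).
  by move: ZAW; rewrite ZP WE !mulmxA.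
have [_ uN] := mulmx1_unit PN; split=> //.
by rewrite ZP -[P](mulmxK uN) PN mul1mx.
Qed.

Lemma outer_inverse_map (K L : fieldType) (f : {rmorphism K -> L}) m n
    (A : 'M[K]_(m, n)) (W Z : 'M[K]_(n, m)) :
  outer_inverse A W Z ->
  outer_inverse (map_mx f A) (map_mx f W) (map_mx f Z).
Proof.
move=> [sr sc e]; split; first by rewrite map_submx.
  by rewrite !matrix.map_trmx map_submx.
by rewrite -!map_mxM e.
Qed.

(** Z = Z (A Z)^* = Z Z^* A^* and Z = (Z A)^* Z = A^* Z^* Z place Z in the row
    and column spaces of A^*. *)
Lemma MP_outer_inverse (C : numClosedFieldType) p (M : 'M[C]_p) m n
    (A : tensor C m n p) k : M \in unitmx ->
  outer_inverse (transform M A k) (transform M (conj_transpose M A) k)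
    (transform M (MPinv M A) k).
Proof.
move=> uM; rewrite (transform_conj A k uM).
have /(is_MPP A _ uM)/(_ k)[] := MPinvP A uM.
move: (transform M A k) (transform M (MPinv M A) k) => {A} A Z AZA ZAZ hAZ hZA.
split.
- by rewrite -[X in (X <= _)%MS]ZAZ -mulmxA -hAZ trmx_mul map_mxM mulmxA submxMl.
- rewrite -{1}ZAZ -{1}hZA [(Z *m A)^T]trmx_mul map_mxM -mulmxA.
  by rewrite [X in (X <= _)%MS]trmx_mul submxMl.
- by rewrite -hZA -map_mxM -trmx_mul mulmxA AZA.
Qed.

(** Iterating Z = Z B Z with Z B = B Z gives Z = Z^(k+1) B^k = B^k Z^(k+1), which
    places Z in the row and column spaces of B^k. *)
Lemma Drazin_outer_inverse (K : fieldType) p (M : 'M[K]_p) m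
    (B : tensor K m m p) i : M \in unitmx ->
  outer_inverse (transform M B i)
    (transform M (mpow M B (tubal_index M B)) i)
    (transform M (Drazin_inv M B) i).
Proof.
move=> uM; rewrite transform_mpow //.
have /(is_DrazinP B _ uM)/(_ i)[] := Drazin_invP B uM.
move: (tubal_index M B) (transform M B i) (transform M (Drazin_inv M B) i).
move=> k {}B Z ZBZ BZ ZBk.
have ZE j : Z = Z ^+ j.+1 * B ^+ j.
  elim: j => [|j IHj]; first by rewrite expr1 mulr1.
  have ZZB : Z * Z * B = Z by rewrite -mulrA -BZ mulrA.
  by rewrite exprSr exprSr exprS mulrA -[_ * Z * Z]mulrA -[_ * (Z * Z) * B]mulrA
    ZZB -exprSr.
have ZB : GRing.comm (Z ^+ k.+1) (B ^+ k).
  by apply/commrX/commr_sym/commrX/commr_sym.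
split.
- by rewrite {1}(ZE k) -mulmxE submxMl.
- by rewrite {1}(ZE k) ZB -mulmxE trmx_mul submxMl.
- by rewrite !mulmxE -mulrA -exprS.
Qed.

Lemma transform_ratfun (C : fieldType) p (M : 'M[C]_p) m n
    (A : tensor C m n p) k :
  transform (map_mx (@ratfunC C) M) (tensor_ratfun A) k =
  map_mx (@ratfunC C) (transform M A k).
Proof.
rewrite !ffunE map_mx_sum; apply: eq_bigr => l _.
by rewrite map_mxZ mxE ffunE.
Qed.

(** The multirank of W has to be constant: the factors have the same inner
    dimension r on all slices, and on a slice of rank below r the product S A Q
    could be singular. *)
Lemma MQDR_outer_inverse (C : fieldType) p (M : 'M[C]_p) m n r
    (A : tensor C m n p) (W Z : tensor C n m p)
    (Q : tensor (ratfun C) n r p) (D : tensor (ratfun C) r r p)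
    (S : tensor (ratfun C) r m p) :
  let Mx := map_mx (@ratfunC C) M in
  M \in unitmx ->
  (forall k, outer_inverse (transform M A k) (transform M W k)
               (transform M Z k)) ->
  multirank M W = [ffun=> r] ->
  is_MQDR Mx (tensor_ratfun W) Q D S ->
  let N := mprod Mx (mprod Mx S (tensor_ratfun A)) Q in
  minvertible Mx N /\
  tensor_ratfun Z = mprod Mx (mprod Mx Q (minv Mx N)) S.
Proof.
move=> Mx uM oZ rW [_ WE _ _ _] N.
have uMx : Mx \in unitmx by rewrite map_unitmx.
have slice k : transform Mx N k \in unitmx /\
    transform Mx (tensor_ratfun Z) k =
    transform Mx Q k *m invmx (transform Mx N k) *m transform Mx S k.
  rewrite !(transform_mprod uMx).
  apply: (@outer_inverse_factor _ _ _ _ _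
            (transform Mx (tensor_ratfun W) k) _ _ (transform Mx D k)).
  - by rewrite !transform_ratfun; apply: outer_inverse_map.
  - by rewrite WE !(transform_mprod uMx).
  - rewrite transform_ratfun mxrank_map.
    by have /ffunP/(_ k) := rW; rewrite !ffunE.
split=> [k|]; first by case: (slice k).
apply: (eq_transform uMx) => k.
by rewrite !(transform_mprod uMx) transform_minv //; case: (slice k).
Qed.

Unset Implicit Arguments.
Theorem corollary3p6 (R : realType) (m n p r k : nat) (M : 'M[R[i]]_p)
    (A : tensor R[i] m n p) (B : tensor R[i] m m p) :
  let Mx := map_mx (@ratfunC R[i]) M in
  M \in unitmx ->
  multirank M A = [ffun=> r] ->
  tubal_index M B = k ->
  (forall (Q : tensor (ratfun R[i]) n r p) (D : tensor (ratfun R[i]) r r p)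
          (S : tensor (ratfun R[i]) r m p),
     is_MQDR Mx (tensor_ratfun (conj_transpose M A)) Q D S ->
     let N := mprod Mx (mprod Mx S (tensor_ratfun A)) Q in
     minvertible Mx N /\
     tensor_ratfun (MPinv M A) = mprod Mx (mprod Mx Q (minv Mx N)) S)
  /\
  (forall (s : nat) (Q : tensor (ratfun R[i]) m s p)
          (D : tensor (ratfun R[i]) s s p) (S : tensor (ratfun R[i]) s m p),
     multirank M (mpow M B k) = [ffun=> s] ->
     is_MQDR Mx (tensor_ratfun (mpow M B k)) Q D S ->
     let N := mprod Mx (mprod Mx S (tensor_ratfun B)) Q in
     minvertible Mx N /\
     tensor_ratfun (Drazin_inv M B) = mprod Mx (mprod Mx Q (minv Mx N)) S).
Proof.
move=> Mx uM rA kB; split=> [Q D S|s Q D S rBk].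
  apply: MQDR_outer_inverse => // [k'|]; first exact: MP_outer_inverse.
  apply/ffunP=> k'; rewrite -rA [LHS]ffunE [RHS]ffunE.
  by rewrite (transform_conj A k' uM) mxrank_map mxrank_tr.
apply: MQDR_outer_inverse => // i; rewrite -kB.
exact: Drazin_outer_inverse.
Qed.
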